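(* Let $G$ be a finite group and let $\mathcal{C}$ be a conjugacy class of $G$. If every $10$ members of $\mathcal{C}$ generate a solvable subgroup, then $\mathcal{C}$ generates a solvable subgroup.
   Context: ''Every $10$ members of $\mathcal{C}$ generate a solvable subgroup'' means that for all $x_1,\dots,x_{10}\in\mathcal{C}$ (not necessarily distinct) the subgroup $\langle x_1,\dots,x_{10}\rangle$ is solvable. *)

From mathcomp Require Import all_boot all_fingroup all_solvable.
From mathcomp Require Import all_algebra mxrepresentation mxabelem.

(** Measure a solvable group H by its iterated nilpotent residuals; the number
    of steps to reach 1 is the Fitting height.  Let h be the largest height of a
    subgroup generated by ten members of C.  The key fact is that a solvable
    group generated by members of C contains five members of C generating a
    subgroup H of the same height.  For g in G, the group <H, H^g> is then
    generated by ten members of C, so it has height h, and its last nontrivial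
    residual is nilpotent and contains those of H and H^g.  By the Baer-Suzuki
    theorem the last residual of H meets some O_q(G) nontrivially, and one
    concludes by induction in G / O_q(G).

    For the five-generator fact, reduce to a group K generated by one class,
    whose last nontrivial residual V is its unique minimal normal subgroup, an
    r-group.  Inductively in K / O_r(X), where X is the previous residual, find
    five conjugates d_i generating H of height h - 1; choose U <= V minimal
    H-invariant without fixed points under the r'-part of the last
    residual of H.  If no choice of u_i in U makes the d_i^(u_i) generate a group
    of height h, then by Schur-Zassenhaus every tuple (d_i^(u_i)) is of the form
    (d_i^v), whence |U : C_U(d)|^5 <= |U|.  But |C_U(d)|^4 <= |U|^3, because a
    double commutator [d, u, w] acts without fixed points, or a single one
    [d, u] moves every Clifford component. *)

Set Implicit Arguments.
Unset Strict Implicit.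
Unset Printing Implicit Defensive.

Import GroupScope GRing.Theory.

(** * Groups generated by one conjugacy class *)

Lemma class_gen_sub (gT : finGroupType) (G N : {group gT}) d :
  G \subset <<d ^: G>> -> G \subset 'N(N) -> d \in N -> G \subset N.
Proof.
move=> sG nNG Nd; apply: subset_trans sG _; rewrite gen_subG.
by apply/subsetP=> _ /imsetP[x Gx ->]; rewrite memJ_norm // (subsetP nNG).
Qed.

Lemma class_gen_quotient (gT : finGroupType) (G L : {group gT}) d :
    d \in G -> G \subset 'N(L) -> G \subset <<d ^: G>> ->
  G / L \subset <<coset L d ^: (G / L)>>.
Proof.
move=> Gd nLG sG; rewrite -morphim_class ?(subsetP nLG) // -morphim_gen.
  exact: morphimS.
by rewrite class_subG ?(subsetP nLG).
Qed.

(** Meant for [M0] the stabilizer of a Clifford component: such a [y] moves every component. Enlarge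
    [M0] to a maximal subgroup [M] and let [R] be minimal among the normal subgroups of [G] not
    inside [M]; then [G = M * R], and the derived subgroup of [R] lies in [M]. *)
Lemma sol_class_gen_commg_notin_conj (gT : finGroupType) (G M0 : {group gT}) d :
    solvable G -> d \in G -> G \subset <<d ^: G>> -> M0 \proper G ->
  exists2 y, y = d \/ (exists2 u, u \in G & y = [~ d, u])
           & {in G, forall g, y \notin M0 :^ g}.
Proof.
move=> solG Gd genG prM0.
have [M maxM sM0M] := @maxgroup_exists _ (fun M => M \proper G) _ prM0.
have prM := maxgroupp maxM; have sMG := proper_sub prM.
suffices [y dy yM]: exists2 y, y = d \/ (exists2 u, u \in G & y = [~ d, u])
           & {in G, forall g, y \notin M :^ g}.
  exists y => // g Gg; apply: contra (yM g Gg); apply: subsetP.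
  by rewrite conjSg.
have PG : (G <| G) && ~~ (G \subset M) by rewrite normal_refl proper_subn.
have [R minR _] := @mingroup_exists _ (fun R => (R <| G) && ~~ (R \subset M)) G PG.
have /andP[nsRG nsRM] := mingroupp minR; have [sRG nRG] := andP nsRG.
have ntR: R :!=: 1 by apply: contraNneq nsRM => ->; rewrite sub1G.
have prR' := sol_der1_proper solG sRG ntR.
have sR'M: R^`(1) \subset M.
  apply: contraTT prR' => nsR'M; have [_ minR'] := mingroupP minR.
  rewrite -[R^`(1)]/(gval R^`(1)%G) (minR' R^`(1)%G) ?properxx ?der_sub //.
  by rewrite nsR'M (char_normal_trans (der_char 1 R)).
have defG: M * R = G.
  rewrite -norm_joinEl ?(subset_trans sMG) //; apply/eqP.
  rewrite eqEproper join_subG sMG sRG /=; apply: contra nsRM => prMR.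
  have [_ maxM'] := maxgroupP maxM.
  by rewrite -(maxM' _ prMR) ?joing_subl ?joing_subr.
have nMR: R :&: M <| G.
  rewrite /normal subIset ?sRG //= -defG mulG_subG; apply/andP; split.
    by rewrite normsI ?normG // (subset_trans sMG).
  by rewrite sub_der1_norm ?subsetIl // subsetI der_sub.
(* Since R :&: M is normal in G, an element of R outside M lies in no conjugate
   of M; if no [~ d, u] works then R centralizes d modulo R :&: M, so M <| G. *)
have RMJ y g : y \in R -> g \in G -> y \in M :^ g -> y \in M.
  move=> Ry Gg; rewrite mem_conjg => Myg.
  have : y ^ g^-1 \in R :&: M by rewrite inE Myg andbT memJ_norm ?groupV ?(subsetP nRG).
  by rewrite memJ_norm ?groupV ?(subsetP (normal_norm nMR)) // inE => /andP[].
have Rcom u : u \in R -> [~ d, u] \in R.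
  by move=> Ru; rewrite commgEr groupM // memJ_norm ?groupV // (subsetP nRG).
have [/existsP[u /andP[Ru nMu]] | ] := boolP [exists u, (u \in R) && ([~ d, u] \notin M)].
  exists [~ d, u]; first by right; exists u => //; apply: (subsetP sRG).
  by move=> g Gg; apply: contra nMu; apply: RMJ; rewrite ?Rcom.
rewrite negb_exists => /forallP dM.
have cRd u : u \in R -> [~ d, u] \in R :&: M.
  by move=> Ru; have:= dM u; rewrite Ru inE Rcom //= negbK.
set L := (R :&: M)%G; have [sLG nLG] := andP (nMR : L <| G).
have nLR := subset_trans sRG nLG; have sLM : L \subset M by apply: subsetIr.
have sGC: G / L \subset 'C(R / L).
  apply: (class_gen_sub (class_gen_quotient Gd nLG genG)).
    by rewrite norms_cent // quotient_norms.
  apply/centP=> _ /morphimP[u nLu Ru ->]; have nLd := subsetP nLG d Gd.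
  apply/esym/commgP; rewrite -morphR //; apply/eqP; apply: coset_id.
  by rewrite -invg_comm groupV cRd.
have nMG: G \subset 'N(M).
  rewrite -{1}defG mulG_subG normG /= -commg_subr (subset_trans _ sLM) //.
  rewrite -quotient_cents2 // ?(subset_trans sMG) //.
  by rewrite centsC (subset_trans _ sGC) // quotientS.
exists d; first by left.
move=> g Gg; rewrite (normsP nMG) //; apply: contra (proper_subn prM) => Md.
exact: class_gen_sub genG _ Md.
Qed.

(** * Fixed points of an element whose class generates *)

Local Open Scope ring_scope.

(** Choose one point in each cycle of [f]: no cycle is a single point, so [X] is disjoint from its
    image under [f]. *)
Lemma fpf_orbit_transversal (T : finType) (f : T -> T) :
    injective f -> (forall x, f x != x) ->
  exists2 X : {set T}, (2 * #|X| <= #|T|)%N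
    & forall y, exists2 x, x \in X & exists k, y = iter k f x.
Proof.
move=> injf fpf; have symf := fconnect_sym injf.
exists [set x | froots f x] => [|y]; last first.
  exists (froot f y); first by rewrite inE roots_root.
  by exists (findex f (froot f y) y); rewrite iter_findex // symf connect_root.
set X := [set x | _]; rewrite mul2n -addnn -[X in (_ + X)%N](card_imset _ injf).
rewrite -cardsUI [X in (_ + X)%N]eq_card0 ?addn0 ?max_card // => x.
rewrite !inE; apply/negP=> /andP[rx /imsetP[z /[!inE] rz def_x]].
have E: froot f z = froot f x by apply/eqP; rewrite root_connect // def_x fconnect1.
have zx: z = x by rewrite -(eqP rz) E (eqP rx).
by have /eqP[] := fpf z; rewrite -def_x.
Qed.

Section RankFix.

Variables (F : fieldType) (gT : finGroupType) (G : {group gT}) (n : nat).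
Variable rG : mx_representation F G n.

(** The fixed spaces of [d] and [d ^ u] have the same dimension, and their intersection is fixed by
    [[~ d, u] = d^-1 * d ^ u]. *)
Lemma rank_rfix_commg d u : d \in G -> u \in G ->
  (2 * \rank (rfix_mx rG [set d]) <= n + \rank (rfix_mx rG [set [~ d, u]%g]))%N.
Proof.
move=> Gd Gu; set A := rfix_mx rG [set d].
have rkAu : \rank (rfix_mx rG [set d ^ u]%g) = \rank A.
  rewrite -conjg_set1 (rfix_mx_conjsg rG) ?sub1set //.
  by rewrite mxrankMfree // row_free_unit repr_mx_unit.
rewrite mul2n -addnn -{2}rkAu -mxrank_sum_cap leq_add ?rank_leq_col //.
apply: mxrankS; apply/rfix_mxP=> _ /set1P->.
set Z := (_ :&: _)%MS.
have fixZ x : (Z <= rfix_mx rG [set x])%MS -> Z *m rG x = Z.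
  by move=> sZ; apply: (rfix_mxP _ sZ); rewrite set11.
rewrite commgEl repr_mxM ?groupV ?groupJ // mulmxA.
rewrite -{1}(fixZ d) ?capmxSl // repr_mxK //.
by rewrite fixZ ?capmxSr.
Qed.

(** The components all have the same rank, and those outside a transversal [X] of the orbits of [y]
    span at least half the space and meet the fixed space trivially. *)
Lemma rank_rfix_components (H : {group gT}) (nsHG : H <| G)
    (sH : socleType (subg_repr rG (normal_sub nsHG))) (irrG : mx_irreducible rG) y :
    y \in G -> (forall W : sH, Clifford_act W y != W) ->
  (2 * \rank (rfix_mx rG [set y]) <= n)%N.
Proof.
move=> Gy fpf; pose f (W : sH) := Clifford_act W y.
have injf : injective f := act_inj (Clifford_action sH) y.
have [X leX genX] := fpf_orbit_transversal injf fpf.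
set Y := rfix_mx _ _; pose S := (\sum_(W : sH | W \notin X) W)%MS.
have actf W : (f W :=: W *m rG y)%MS := val_Clifford_act W Gy.
have dxH := Socle_direct sH; have S1 := Clifford_Socle1 irrG sH.
(* The components of a vector fixed by y along an orbit of y are determined by
   any one of them. *)
have YS0 : (Y :&: S = 0)%MS.
  set V := (Y :&: S)%MS; have sVY : (V <= Y)%MS := capmxSl _ _.
  have yV : V *m rG y = V by apply: (rfix_mxP _ sVY); rewrite set11.
  have sV1 : (V <= \sum_(W : sH) W)%MS.
    by rewrite -/(Socle sH) S1 submx1.
  have [V_ sV_ defV uniqV] := sub_dsumsmx dxH sV1.
  have Vf W : V_ (f W) = V_ W *m rG y.
    pose C (W' : sH) := V_ (invF injf W') *m rG y.
    rewrite -[W in RHS](invF_f injf) -/(C (f W)); apply/esym/uniqV => // [W' _|].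
      by rewrite -[W' in X in (_ <= X)%MS](f_invF injf) actf submxMr ?sV_.
    rewrite -yV defV mulmx_suml [RHS](reindex_inj injf) /=.
    by apply: eq_bigr => W' _; rewrite /C invF_f.
  have V0 W : W \in X -> V_ W = 0.
    move=> XW; have /sub_sumsmxP[u defVu] : (V <= S)%MS := capmxSr _ _.
    pose C (W' : sH) := if W' \in X then 0 else u W' *m W'.
    have <- : C W = V_ W; last by rewrite /C XW.
    apply: uniqV => // [W' _|]; first by rewrite /C; case: ifP; rewrite ?sub0mx ?submxMl.
    rewrite defVu big_mkcond /=; apply: eq_bigr => W' _.
    by rewrite /C; case: (W' \in X).
  rewrite -/V defV big1 // => W _; have [W0 XW0 [k ->]] := genX W.
  by elim: k => [|k IHk]; [apply: V0 | rewrite iterS Vf IHk mul0mx].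
have rkW (W : sH) : (#|sH| * \rank W)%N = n := Clifford_rank_components irrG W.
have [_ nz1 _] := irrG.
have [W0 _] : exists W0 : sH, True.
  by case/imsetP: (Clifford_atrans irrG sH) => W0; exists W0.
pose r := \rank W0.
have rkWr (W : sH) : \rank W = r.
  have s_gt0 : (0 < #|sH|)%N by apply/card_gt0P; exists W0.
  by apply/eqP; rewrite -(eqn_pmul2l s_gt0) !rkW.
have rkS : \rank S = (#|[set: sH] :\: X| * r)%N.
  rewrite (mxdirectP (subSocle_direct (fun W : sH => W \notin X))) /=.
  rewrite (eq_bigr (fun=> r)) => [|W _]; last exact: rkWr.
  by rewrite sum_nat_const; congr (_ * _)%N; apply: eq_card => W; rewrite !inE andbT.
have := rank_leq_col (Y + S)%MS; rewrite mxrank_disjoint_sum // rkS setTD.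
have defn := rkW W0; rewrite -(cardsC X) mulnDl -/r in defn.
rewrite -[X in (_ <= X)%N -> _]defn leq_add2r => leYX.
rewrite (leq_trans (leq_mul (leqnn 2) leYX)) //.
by rewrite -[X in (_ <= X)%N](rkW W0) mulnA leq_mul2r leX orbT.
Qed.
End RankFix.

Section HomogeneousFix.

Variables (F : fieldType) (gT : finGroupType) (G : {group gT}) (n : nat).
Variable rG : mx_representation F G n.
Hypotheses (irrG : mx_irreducible rG) (ffulG : mx_faithful rG).

(** As [H] is abelian, the fixed space of [t] is an [H]-module. If nonzero, it contains a simple
    one; with a single component the whole space is a sum of copies of it, so [t] acts trivially,
    against faithfulness. *)
Lemma rfix_homogeneous_abelian (H : {group gT}) (nsHG : H <| G)
    (sH : socleType (subg_repr rG (normal_sub nsHG))) t :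
    abelian H -> (#|sH| <= 1)%N -> t \in H -> t != 1%g ->
  rfix_mx rG [set t] = 0.
Proof.
move=> cHH sH1 Ht ntt; apply/eqP; apply: contraTT isT => nzX.
have sHG := normal_sub nsHG; have Gt := subsetP sHG t Ht.
pose rH := subg_repr rG (normal_sub nsHG); set X := rfix_mx _ _ in nzX.
have modX : mxmodule rH X.
  apply/mxmoduleP=> x Hx; have Gx := subsetP sHG x Hx.
  apply/rfix_mxP=> _ /set1P->; rewrite -mulmxA -repr_mxM // (centsP cHH x Hx t Ht).
  by rewrite repr_mxM // mulmxA rfix_mx_id ?set11.
apply: (mxsimple_exists modX nzX) => [[M simM sMX]] /=.
have sub1M : (1%:M <= component_mx rH M)%MS.
  rewrite -(Clifford_Socle1 irrG sH); apply/sumsmx_subP=> W _.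
  have -> : W = PackSocle (component_socle sH simM).
    exact: (fintype_le1P sH1).
  by rewrite PackSocleK.
have [I [V isoV defM]] := component_mx_def simM.
have fix1 : (1%:M <= X)%MS.
  rewrite (submx_trans sub1M) // defM; apply/sumsmx_subP=> i _.
  have [f _ /hom_mxP homf <-] := isoV i.
  apply/rfix_mxP=> _ /set1P->; rewrite -homf //; congr (_ *m f).
  by apply: (rfix_mxP [set t] sMX); rewrite set11.
case/negP: ntt; rewrite -in_set1; apply: (subsetP ffulG).
by rewrite inE Gt (rfix_mxP _ fix1) ?set11 /=.
Qed.

End HomogeneousFix.

Section RankFixClass.

Variables (F : decFieldType) (gT : finGroupType) (G : {group gT}) (n : nat).
Variables (rG : mx_representation F G n) (d : gT).
Hypotheses (irrG : mx_irreducible rG) (ffulG : mx_faithful rG).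
Hypotheses (solG : solvable G) (Gd : d \in G) (genG : (G \subset <<d ^: G>>)%g).

Let commg_or_self y := y = d \/ exists2 u, u \in G & y = [~ d, u]%g.
Let large_support :=
  exists2 y, commg_or_self y & (2 * \rank (rfix_mx rG [set y]) <= n)%N.

(** [G] permutes the components transitively, so if there are several, an element outside all
    conjugates of the stabilizer [M] of one of them moves them all. *)
Let abelian_fix (H : {group gT}) t :
  H <| G -> abelian H -> t \in H -> t != 1%g ->
  large_support \/ rfix_mx rG [set t] = 0.
Proof.
move=> nsHG cHH Ht ntt.
pose sH := DecSocleType (subg_repr rG (normal_sub nsHG)).
have [sH1 | sHgt1] := leqP #|sH| 1; [right | left].
  exact: rfix_homogeneous_abelian sH1 Ht ntt.
have trG := Clifford_atrans irrG sH; have [W0 _ defW0] := imsetP trG.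
pose M := rstabs rG W0; have defM : 'C[W0 | Clifford_action sH] = M by apply: Clifford_astab1.
have prM : M \proper G.
  rewrite properE rstabs_sub; apply: contraL sHgt1 => sGM.
  rewrite -leqNgt -cardsT defW0; apply: leq_trans (_ : #|[set W0]| <= 1)%N.
    apply/subset_leq_card/subsetP=> _ /imsetP[x Gx ->].
    by rewrite inE -[X in _ == X](astab_act (S := [set W0]) (a := x)
      (to := Clifford_action sH)) ?set11 // defM (subsetP sGM).
  by rewrite cards1.
have [y dy yM] := sol_class_gen_commg_notin_conj solG Gd genG prM.
exists y => //; have Gy : y \in G.
  by case: dy => [-> // | [u Gu ->]]; rewrite groupR.
apply: (rank_rfix_components (sH := sH)) => // W.
have [x Gx ->] : exists2 x, x \in G & W = Clifford_action sH W0 x.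
  by apply/imsetP; have := in_setT W; rewrite defW0.
apply: contra (yM x Gx) => /eqP fixW; rewrite -[gval _]/M -defM.
rewrite -astab1_act_in // !inE Gy; apply/subsetP=> _ /set1P->.
by rewrite inE; apply/eqP.
Qed.

(** By [rank_rfix_commg], a bound [n / 2] on the fixed space of one commutator [[~ d, u]] gives
    [3 * n / 4] for [d]. *)
Lemma rank_rfix_class_gen :
  d != 1%g -> (4 * \rank (rfix_mx rG [set d]) <= 3 * n)%N.
Proof.
move=> ntd; suffices [y dy fy]: large_support.
  have fd : (2 * \rank (rfix_mx rG [set d]) <= n + \rank (rfix_mx rG [set y]))%N.
    case: dy => [<- | [u Gu ->]]; last exact: rank_rfix_commg.
    by rewrite mul2n -addnn leq_add2r rank_leq_col.
  have := leq_mul (leqnn 2) fd; rewrite mulnA mulnDr => /leq_trans-> //.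
  by rewrite addnC (mulSn 2) leq_add2r.
have fix0 y : commg_or_self y -> rfix_mx rG [set y] = 0 -> large_support.
  by move=> dy fix0; exists y; rewrite // fix0 mxrank0.
have [cGd | ncGd] := boolP (d \in 'C(G))%g.
  have Zd : d \in 'Z(G)%g by rewrite inE Gd.
  have [] := abelian_fix (center_normal G) (center_abelian G) Zd ntd => //.
  by apply: fix0; left.
(* A minimal such T has central derived subgroup, so the double commutators
   below lie in an abelian normal subgroup. *)
pose P (T : {group gT}) := (T <| G) && (d \notin 'C(T))%g.
have PG : P G by rewrite /P normal_refl.
have [T /mingroupP[/andP[nsTG ncTd] minT] _] := mingroup_exists PG.
have [sTG nTG] := andP nsTG.
have cGproper (S : {group gT}) : S <| G -> S \proper T -> G \subset 'C(S)%g.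
  move=> nsSG /andP[sST nsTS]; apply: (class_gen_sub genG).
    by rewrite norms_cent // normal_norm.
  apply: contraR nsTS => ncS; rewrite -(minT S) //.
  by rewrite /P nsSG.
have [u Tu ntu] : exists2 u, u \in T & [~ d, u]%g != 1%g.
  have: ~~ (T \subset 'C[d])%g by rewrite -cent_set1 centsC sub1set.
  case/subsetPn=> u Tu ncdu; exists u => //.
  by apply: contra ncdu => /commgP cdu; apply/cent1P.
set y := [~ d, u]%g in ntu; have Gu := subsetP sTG u Tu.
have dy : commg_or_self y by right; exists u.
have Ty : y \in T by rewrite /y commgEr groupM // memJ_norm ?groupV // (subsetP nTG).
have [cTy | ] := boolP (y \in 'C(T))%g.
  have nsZG : 'Z(T)%g <| G by rewrite (char_normal_trans (center_char _)).
  have Zy : y \in 'Z(T)%g by rewrite inE Ty.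
  by have [] := abelian_fix nsZG (center_abelian _) Zy ntu; last exact: fix0.
move=> ncTy.
have [w Tw ntw] : exists2 w, w \in T & [~ y, w]%g != 1%g.
  have: ~~ (T \subset 'C[y])%g by rewrite -cent_set1 centsC sub1set.
  case/subsetPn=> w Tw ncyw; exists w => //.
  by apply: contra ncyw => /commgP cdu; apply/cent1P.
have ntT : T :!=: 1%g by apply: contraNneq ntu => T1; rewrite T1 inE in Ty.
have nsT'G : T^`(1)%g <| G by rewrite (char_normal_trans (der_char 1 T)).
have cGT' : G \subset 'C(T^`(1))%g.
  by apply: cGproper; rewrite // (sol_der1_proper solG).
have abT' : abelian T^`(1)%g.
  by rewrite /abelian (subset_trans _ cGT') ?normal_sub.
have [//|z0] := abelian_fix nsT'G abT' (mem_commg Ty Tw) ntw.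
exists y => //; have := rank_rfix_commg rG (subsetP sTG y Ty) (subsetP sTG w Tw).
by rewrite z0 mxrank0 addn0.
Qed.

End RankFixClass.

(** View [U] as an irreducible module over the prime field and divide out the kernel ['C_H(U)] to
    make it faithful; modulo this kernel the class of [d] generates [H]. *)
Lemma card_cent_class_gen (gT : finGroupType) (p : nat) (U H : {group gT}) d :
    p.-abelem U -> minnormal U H -> solvable H -> d \in H ->
    H \subset (<<d ^: H>> <*> 'C_H(U))%g -> d \notin ('C(U))%g ->
  (#|('C_U[d])%g| ^ 4 <= #|U| ^ 3)%N.
Proof.
move=> abelU minU solH Hd genH ncUd.
have /andP[ntU nUH] : (U :!=: 1%g) && (H \subset 'N(U))%g := mingroupp minU.
have [p_pr _ _] := pgroup_pdiv (abelem_pgroup abelU) ntU.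
pose rU := abelem_repr abelU ntU nUH.
have irrU : mx_irreducible rU by apply/abelem_mx_irrP.
have kerU : rker rU = 'C_H(U)%g := rker_abelem abelU ntU nUH.
have nKH := rker_norm rU; have nKd := subsetP nKH d Hd.
pose K := [group of rker rU].
have genHK : (H / K \subset <<coset K d ^: (H / K)>>)%g.
  rewrite -morphim_class // -morphim_gen ?class_subG //.
  rewrite -[_ @* _]/(_ / _)%g -(quotientYidr (G := <<_>>%G)).
    by rewrite quotientS // [gval K]kerU.
  by rewrite gen_subG class_subG.
have ntd : coset K d != 1%g.
  apply: contra ncUd => /eqP/coset_idr-/(_ nKd) Kd.
  by have : d \in rker rU by []; rewrite kerU => /setIP[].
have := rank_rfix_class_gen (rG := kquo_repr rU) _ _ _ _ genHK ntd.
have -> : \rank (rfix_mx (kquo_repr rU) [set coset K d]) = logn p #|'C_U[d]|%g.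
  have sd : [set d] \subset H by rewrite sub1set.
  have -> : \rank (rfix_mx (kquo_repr rU) [set coset K d]) = \rank (rfix_mx rU [set d]).
    apply/eqmx_rank/andP; split; apply/rfix_mxP=> _ /set1P->.
      by rewrite -(kquo_repr_coset rU Hd) rfix_mx_id ?set11.
    by rewrite [_ (coset K d)](kquo_repr_coset rU Hd) rfix_mx_id ?set11.
  rewrite (rfix_abelem abelU ntU nUH sd) mxrank_rowg //.
  rewrite card_injm ?abelem_rV_injm ?subsetIl //.
  by rewrite /= cent_set1.
have [kU kC] : #|U| = (p ^ logn p #|U|)%N /\ #|'C_U[d]|%g = (p ^ logn p #|'C_U[d]|%g)%N.
  have pU := abelem_pgroup abelU; have pC := pgroupS (subsetIl U 'C[d]%g) pU.
  by rewrite -!p_part !part_pnat_id.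
move=> le43; rewrite kU kC -!expnM leq_exp2l ?prime_gt1 // mulnC [leqRHS]mulnC.
rewrite -(dim_abelemE abelU ntU) le43 //; first exact/quo_mx_irr.
- exact: kquo_mx_faithful.
- exact: quotient_sol.
exact: mem_quotient.
Qed.

Close Scope ring_scope.
Local Open Scope group_scope.

(** * Iterated nilpotent residuals *)

(* N is meant to bound the orders of all the groups involved, so that 'L_N is
   the nilpotent residual; sharing one N makes nilres commute with quotients. *)
Definition nilres (N k : nat) (gT : finGroupType) (A : {set gT}) : {set gT} :=
  iter k (fun B => 'L_N(B)) A.

Section NilpotentResidual.

Variable N : nat.
Implicit Types gT rT : finGroupType.

Lemma nilres_group_set k gT (G : {group gT}) : group_set (nilres N k G).
Proof.
rewrite /nilres; elim: k => [|k IHk]; first exact: groupP.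
rewrite iterS; exact: (lcn_group_set N (Group IHk)).
Qed.
Canonical nilres_group k gT (G : {group gT}) := Group (nilres_group_set k G).

Lemma nilres_char k gT (G : {group gT}) : nilres N k G \char G.
Proof.
elim: k => [|k IHk]; first exact: char_refl.
exact: char_trans (lcn_char N (nilres_group k G)) IHk.
Qed.

Lemma nilres_sub k gT (G : {group gT}) : nilres N k G \subset G.
Proof. exact/char_sub/nilres_char. Qed.

Lemma nilresS k gT (A B : {set gT}) :
  A \subset B -> nilres N k A \subset nilres N k B.
Proof. by move=> sAB; elim: k => //= k IHk; apply: lcnS. Qed.

Lemma morphim_nilres k gT rT (D : {group gT}) (f : {morphism D >-> rT})
    (G : {group gT}) :
  G \subset D -> f @* nilres N k G = nilres N k (f @* G).
Proof.
move=> sGD; elim: k => //= k IHk.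
by rewrite morphim_lcn ?IHk // (subset_trans (nilres_sub k G)).
Qed.

Lemma quotient_nilres k gT (G M : {group gT}) :
  G \subset 'N(M) -> nilres N k G / M = nilres N k (G / M).
Proof. exact: morphim_nilres. Qed.

(** The class of a nilpotent group is smaller than its order, so the lower central series has ended
    by index [N]. *)
Lemma lcn_bound_eq1 gT (G : {group gT}) :
  #|G| <= N -> ('L_N(G) == 1) = nilpotent G.
Proof.
move=> leGN; have N_gt0 : 0 < N := leq_trans (cardG_gt0 G) leGN.
apply/eqP/idP=> [L1 | nilG].
  by apply/lcnP; exists N.-1; rewrite prednK.
apply/trivgP; rewrite -(lcn_nil_classP _ nilG (leqnn _)); apply: lcn_sub_leq.
by rewrite nilpotent_class in nilG; apply: leq_trans nilG leGN.
Qed.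

(** Indexing starts with ['L_1(G) = G], so [1 < N] is what puts each residual inside the derived
    subgroup. *)
Lemma sol_nilres gT (G : {group gT}) : 1 < N -> solvable G -> exists k, nilres N k G = 1.
Proof.
move=> N_gt1 /derivedP[k Gk1]; exists k; apply/trivgP.
apply: (@subset_trans _ _ G^`(k)); last by rewrite Gk1.
elim: k {Gk1} => //= k IHk.
rewrite dergSn; apply: subset_trans (dergS 1 IHk).
by rewrite -lcn2; apply: lcn_sub_leq.
Qed.

(** Fitting's theorem at each step: modulo the join of the next residuals, the current ones become
    nilpotent normal subgroups, so their join is nilpotent. *)
Lemma nilres_join k gT (G A B : {group gT}) :
    #|G| <= N -> A <| G -> B <| G ->
  nilres N k (A <*> B) \subset nilres N k A <*> nilres N k B.
Proof.
move=> leGN nsAG nsBG; elim: k => //= k IHk.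
apply: subset_trans (lcnS N IHk) _.
set X := nilres_group k A; set Y := nilres_group k B.
have nsXG : X <| G := char_normal_trans (nilres_char k A) nsAG.
have nsYG : Y <| G := char_normal_trans (nilres_char k B) nsBG.
have nsLX : 'L_N(X) <| G := char_normal_trans (lcn_char N X) nsXG.
have nsLY : 'L_N(Y) <| G := char_normal_trans (lcn_char N Y) nsYG.
set M := ('L_N(X) <*> 'L_N(Y))%G.
have nsMG : M <| G by rewrite normalY.
have [sMG nMG] := andP nsMG.
have nilq (Z : {group gT}) : Z <| G -> 'L_N(Z) \subset M -> Z / M \subset 'F(G / M).
  move=> nsZG sLM; apply: Fitting_max; first exact: quotient_normal.
  rewrite -lcn_bound_eq1; last first.
    by rewrite (leq_trans (leq_quotient _ _)) // (leq_trans (subset_leq_card (normal_sub nsZG))).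
  have -> : 'L_N(Z / M) = 'L_N(Z) / M.
    by rewrite [RHS]morphim_lcn ?(subset_trans (normal_sub nsZG)).
  rewrite -subG1 quotient_sub1 //.
  exact: subset_trans (lcn_sub N Z) (subset_trans (normal_sub nsZG) nMG).
have sXYG : X <*> Y \subset G by rewrite join_subG !normal_sub.
have sXYF : (X <*> Y) / M \subset 'F(G / M).
  rewrite quotientY ?(subset_trans (normal_sub nsXG)) ?(subset_trans (normal_sub nsYG)) //.
  by rewrite join_subG !nilq ?joing_subl ?joing_subr.
rewrite -quotient_sub1; last first.
  exact: subset_trans (lcn_sub N (X <*> Y)) (subset_trans sXYG nMG).
rewrite [_ / _]morphim_lcn ?(subset_trans sXYG) //; apply/trivgP/eqP.
rewrite lcn_bound_eq1; first exact: nilpotentS sXYF (Fitting_nil _).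
by rewrite (leq_trans (leq_morphim _ _)) // (leq_trans (subset_leq_card sXYG)).
Qed.

End NilpotentResidual.

(** * Five conjugates *)

Section Regenerate.

Variables (N k : nat) (gT : finGroupType) (r : nat) (U : {group gT}).
Variable I : finType.

Let gen (d : I -> gT) : {group gT} := <<[set d i | i : I]>>%G.

(** Modulo [U] the two families agree, so the r'-parts [P] and [Q] of the two residuals have the
    same image and are conjugate by some [v] in [U]. Then [d i ^ u i] and [d i ^ v] both normalize
    [Q] and differ by an element of ['N_U(Q) = 1]. *)
Lemma conj_regeneration (d u : I -> gT) :
    r.-group U -> gen d \subset 'N(U) -> 'C_U('O_r^'(nilres N k (gen d))) = 1 ->
    nilpotent (nilres N k (gen d)) ->
    (forall i, u i \in U) -> nilpotent (nilres N k (gen (fun i => d i ^ u i))) ->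
  exists2 v, v \in U & forall i, d i ^ u i = d i ^ v.
Proof.
move=> rU nUH cUP nilB Uu; set e := fun i => _; set H := gen d in nUH nilB cUP *.
set L := gen e => nilBL.
have nUd i : d i \in 'N(U) by rewrite (subsetP nUH) // mem_gen ?imset_f.
have nUu i : u i \in 'N(U) by rewrite (subsetP (normG U)).
have ceq i v : v \in U -> coset U (d i ^ v) = coset U (d i).
  by move=> Uv; rewrite morphJ //= ?(coset_id Uv) ?conjg1 // (subsetP (normG U)).
have sdN : [set d i | i : I] \subset 'N(U).
  by apply/subsetP=> _ /imsetP[i _ ->].
have seN : [set e i | i : I] \subset 'N(U).
  by apply/subsetP=> _ /imsetP[i _ ->]; rewrite groupJ.
have nUL : L \subset 'N(U) by rewrite gen_subG.
have quoLH : L / U = H / U.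
  rewrite /L /H /gen /= !quotient_gen //; congr <<_>>.
  rewrite /quotient !morphimEsub //.
  rewrite -!imset_comp; apply: eq_imset => i /=; exact: ceq.
pose P := 'O_r^'(nilres N k H)%G; pose Q := 'O_r^'(nilres N k L)%G.
have sPH : P \subset H by rewrite (subset_trans (pcore_sub _ _)) ?nilres_sub.
have sQL : Q \subset L by rewrite (subset_trans (pcore_sub _ _)) ?nilres_sub.
have nPH : H \subset 'N(P).
  by rewrite (char_norm_trans (pcore_char _ _)) // (char_norm (nilres_char _ _ _)).
have nQL : L \subset 'N(Q).
  by rewrite (char_norm_trans (pcore_char _ _)) // (char_norm (nilres_char _ _ _)).
have hallP : r^'.-Hall(nilres N k H) P := nilpotent_pcore_Hall _ nilB.
have hallQ : r^'.-Hall(nilres N k L) Q := nilpotent_pcore_Hall _ nilBL.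
have [nUP nUQ] := (subset_trans sPH nUH, subset_trans sQL nUL).
have coU (S : {group gT}) : r^'.-group S -> coprime #|U| #|S|.
  exact: pnat_coprime rU.
have r'P : r^'.-group P := pcore_pgroup _ _.
have r'Q : r^'.-group Q := pcore_pgroup _ _.
have quoQP : Q / U = P / U.
  have quoB : nilres N k L / U = nilres N k H / U by rewrite !quotient_nilres // quoLH.
  have hallPU := quotient_pHall nUP hallP; have hallQU := quotient_pHall nUQ hallQ.
  rewrite quoB in hallQU; have nilBU : nilpotent (nilres N k H / U) by apply: quotient_nil.
  have hallO := nilpotent_pcore_Hall r^' nilBU.
  by rewrite (eq_Hall_pcore hallO hallPU) (eq_Hall_pcore hallO hallQU).
have cardQP : #|Q| = #|P|.
  have cardq (S : {group gT}) : r^'.-group S -> S \subset 'N(U) -> #|S| = #|S / U|.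
    move=> r'S nUS; apply: card_isog; apply: quotient_isog => //.
    by rewrite coprime_TIg // coU.
  by rewrite (cardq Q) // quoQP -cardq.
have [|v Uv defQ] := SchurZassenhaus_trans_sol (pgroup_sol rU) nUP _ (coU P r'P) cardQP.
  by rewrite -quotientSK // quoQP.
exists v => // i.
have NUP : 'N_U(P) = 1.
  apply/trivgP; rewrite -cUP subsetI subsetIl /= -/P; apply/commG1P/trivgP.
  rewrite -(coprime_TIg (coU P r'P)) subsetI; apply/andP; split.
    by rewrite (subset_trans (commSg _ (subsetIl _ _))) // commg_subl.
  by rewrite commg_subr subsetIr.
have NUQ : 'N_U(Q) = 1.
  rewrite -[U in 'N_U(_)](conjGid Uv) [gval Q]defQ normJ -conjIg NUP conjs1g //.
have Nx : d i ^ u i \in 'N(Q) by rewrite (subsetP nQL) // mem_gen // (imset_f e).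
have Ny : d i ^ v \in 'N(Q).
  by rewrite [gval Q]defQ normJ memJ_conjg (subsetP nPH) // mem_gen ?imset_f.
apply/eqP; rewrite eq_mulgV1 -in_set1 -[[set 1]]NUQ inE.
rewrite [_ \in 'N(Q)]groupM ?groupV // andbT.
have nUv := subsetP (normG U) v Uv.
have nUx : d i ^ u i * (d i ^ v)^-1 \in 'N(U) by rewrite groupM ?groupV ?groupJ.
apply: coset_idr => //; rewrite morphM ?morphV ?groupV ?groupJ //=.
by rewrite !ceq // mulgV.
Qed.

Lemma card_family_const (T : finType) m (A : I -> {set T}) :
  (forall i, #|A i| = m) -> #|family A| = (m ^ #|I|)%N.
Proof.
move=> cardA; rewrite card_family foldrE big_map big_enum /=.
by rewrite (eq_bigr (fun=> m)) ?prod_nat_const.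
Qed.

(** If every [u] fails, sending [v] to the family of all [d i ^ v] maps [U] onto the product of the
    classes [d i ^: U]. Conjugacy modulo ['C(U)] gives these classes equal sizes, and five factors
    are enough to contradict [card_cent_class_gen]. *)
Lemma regeneration (d : I -> gT) i0 :
    4 < #|I| -> r.-abelem U -> minnormal U (gen d) -> solvable (gen d) ->
    nilpotent (nilres N k (gen d)) -> 'C_U('O_r^'(nilres N k (gen d))) = 1 ->
    (forall i, exists2 h, h \in gen d & (d i0 ^ h)^-1 * d i \in 'C(U)) ->
  exists2 u : I -> gT, forall i, u i \in U
    & ~~ nilpotent (nilres N k (gen (fun i => d i ^ u i))).
Proof.
move=> I5 abelU minU solH nilB cUP conjd; set H := gen d in minU solH nilB cUP conjd *.
have [rU cUU _] := and3P abelU; have /andP[ntU nUH] := mingroupp minU.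
have [/existsP[u /andP[/forallP Uu nilu]] | ] := boolP [exists u : {ffun I -> gT},
    [forall i, u i \in U] && ~~ nilpotent (nilres N k (gen (fun i => d i ^ u i)))].
  by exists u.
rewrite negb_exists => /forallP allnil.
have regen u : (forall i, u i \in U) -> exists2 v, v \in U & forall i, d i ^ u i = d i ^ v.
  move=> Uu; apply: conj_regeneration => //; have := allnil (finfun u).
  have -> /= : [forall i, finfun u i \in U] by apply/forallP=> i; rewrite ffunE.
  have genE : [set d i ^ finfun u i | i : I] = [set d i ^ u i | i : I].
    by apply: eq_imset => i; rewrite ffunE.
  by rewrite negbK /gen /= genE.
have dH i : d i \in H by rewrite mem_gen ?imset_f.
pose C := 'C_U[d i0].
have cardC i : #|'C_U[d i]| = #|C|.
  have [h Hh cU] := conjd i.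
  rewrite -(cardJg C h) conjIg (normsP nUH) // -cent1J.
  congr #|pred_of_set _|; apply/setP=> x; rewrite !in_setI; apply: andb_id2l => Ux.
  rewrite 2![x \in _]cent1C -[d i](mulKVg (d i0 ^ h)) groupMr //.
  by apply/cent1P; apply: (centP cU).
have cardcl i : #|d i ^: U| = #|U : C|.
  by rewrite -index_cent1 -!divgS ?subsetIl // cardC.
have leU : #|U : C| ^ 5 <= #|U|.
  pose f (v : gT) := [ffun i => d i ^ v].
  apply: leq_trans (leq_imset_card f U).
  apply: leq_trans (_ : #|family (fun i => d i ^: U)| <= _).
    by rewrite (card_family_const cardcl) leq_pexp2l.
  apply/subset_leq_card/subsetP=> w /familyP cl_w.
  pose u i := repr [set x in U | d i ^ x == w i].
  have u_spec i : (u i \in U) /\ d i ^ u i = w i.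
    have /imsetP[x Ux def_w] := cl_w i.
    suffices : u i \in [set x in U | d i ^ x == w i] by rewrite inE => /andP[? /eqP].
    by apply: (mem_repr x); rewrite inE Ux def_w /=.
  have [v Uv def_u] := regen u (fun i => (u_spec i).1).
  apply/imsetP; exists v => //; apply/ffunP=> i; rewrite ffunE -def_u.
  by case: (u_spec i).
have sHC : d i0 \in 'C(U) -> H \subset 'C(U).
  move=> cUd0; rewrite gen_subG; apply/subsetP=> _ /imsetP[i _ ->].
  have [h Hh cU] := conjd i; rewrite -[d i](mulKVg (d i0 ^ h)) groupM //.
  by rewrite memJ_norm // (subsetP (norms_cent nUH)).
have ncUd : d i0 \notin 'C(U).
  apply: contra ntU => /sHC cUH; rewrite -subG1 -cUP subsetI subxx /= centsC.
  by rewrite (subset_trans _ cUH) // (subset_trans (pcore_sub _ _)) ?nilres_sub.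
have genH : H \subset <<d i0 ^: H>> <*> 'C_H(U).
  rewrite gen_subG; apply/subsetP=> _ /imsetP[i _ ->].
  have [h Hh cU] := conjd i; rewrite -[d i](mulKVg (d i0 ^ h)) groupM //.
    by rewrite (subsetP (joing_subl _ _)) // mem_gen // imset_f.
  rewrite (subsetP (joing_subr _ _)) // inE cU andbT.
  by rewrite groupM ?groupV ?groupJ.
have := card_cent_class_gen abelU minU solH (dH i0) genH ncUd; rewrite -/C.
have := Lagrange (subsetIl U 'C[d i0]); rewrite -/C => defU.
move: leU ntU; rewrite trivg_card1 -defU; have := cardG_gt0 C; have := indexg_gt0 U C.
move: #|U : C| #|C| => m c; rewrite !expnMn => m_gt0 c_gt0 le1 nt1 le2.
(* The bounds amount to [m ^ 5 <= c * m] and [c <= m ^ 3], so [m ^ 5 <= m ^ 4]; this forces [m = 1]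
   and then [c = 1]. *)
have le3 : c <= m ^ 3.
  have c3_gt0 : 0 < c ^ 3 by rewrite expn_gt0 c_gt0.
  by rewrite -(leq_pmul2l c3_gt0) -expnSr.
have m1 : m = 1%N.
  apply/eqP; rewrite eqn_leq m_gt0 andbT leqNgt; apply/negP=> m_gt1.
  have : m ^ 5 <= m ^ 4 by rewrite (leq_trans le1) // [leqRHS]expnSr leq_mul2r le3 orbT.
  by rewrite leq_exp2l.
by case/eqP: nt1; rewrite m1 in le3 *; apply/eqP; rewrite eqn_leq muln1 le3.
Qed.

End Regenerate.

Lemma lift_quotient_gen (gT : finGroupType) (I : finType) (M : {group gT}) (C : {set gT})
    (dq : I -> coset_of M) :
    C \subset 'N(M) -> (forall i, dq i \in C / M) ->
  exists d : I -> gT, [/\ forall i, d i \in C, forall i, coset M (d i) = dq i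
    & <<[set d i | i : I]>> / M = <<[set dq i | i : I]>>].
Proof.
move=> nMC Cdq; have [i | d d_spec] := @fin_all_exists I _ (fun i x => x \in C /\ coset M x = dq i).
  by have /morphimP[x _ Cx ->] := Cdq i; exists x.
have Cd i : d i \in C by case: (d_spec i).
have sdC : [set d i | i : I] \subset 'N(M).
  by apply: subset_trans nMC; apply/subsetP=> _ /imsetP[i _ ->].
exists d; split=> // [i|]; first by case: (d_spec i).
rewrite quotient_gen // /quotient morphimEsub // -imset_comp.
by congr <<_>>; apply: eq_imset => i; case: (d_spec i).
Qed.

(** By [nilres_join], a maximal normal subgroup with trivial residual absorbs every other one; it
    would contain [D] if all the classes failed. *)
Lemma generated_by_class (N k : nat) (gT : finGroupType) (K : {group gT}) (D : {set gT}) :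
    #|K| <= N -> D \subset K -> K \subset 'N(D) -> nilres N k <<D>> != 1 ->
  exists2 d, d \in D & nilres N k <<d ^: K>> != 1.
Proof.
move=> leKN sDK nDK ntD; apply/exists_inP; apply: contraR ntD.
rewrite negb_exists_in => /forall_inP trivD.
pose P (M : {group gT}) := (M <| K) && (nilres N k M == 1).
have P1 : P 1%G by rewrite /P normal1 -subG1 nilres_sub.
have [M /maxgroupP[/andP[nsMK /eqP triv_M] maxM] _] := maxgroup_exists P1.
suffices sDM : <<D>> \subset M by rewrite -subG1 -triv_M nilresS.
rewrite gen_subG; apply/subsetP=> d Dd; have Kd := subsetP sDK d Dd.
have nsdK : <<d ^: K>> <| K.
  by rewrite /normal gen_subG class_subG // norms_gen // class_norm.
rewrite -(maxM (M <*> <<d ^: K>>)%G) ?joing_subl //.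
  by rewrite (subsetP (joing_subr _ _)) // mem_gen // class_refl.
rewrite /P normalY // -subG1 (subset_trans (nilres_join k leKN nsMK nsdK)) //.
by rewrite triv_M (eqP (negbNE (trivD d Dd))) joing1G.
Qed.

(** Conjugacy is required inside [H] itself, so that in the induction [H] acts on a module as a
    group generated by the class of one generator. *)
Definition five_conjugates (N k : nat) (gT : finGroupType) (D : {set gT}) :=
  exists d : 'I_5 -> gT, let H := <<[set d i | i : 'I_5]>> in
  [/\ forall i, d i \in D, nilres N k H != 1
    & forall i j, exists2 h, h \in H & d j = d i ^ h].

Lemma nil_pcoreC_trivg_pgroup (gT : finGroupType) (pi : nat_pred) (G : {group gT}) :
  nilpotent G -> 'O_pi^'(G) = 1 -> pi.-group G.
Proof.
by move=> nilG triv; rewrite -(nilpotent_pcoreC pi nilG) triv dprodg1 pcore_pgroup.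
Qed.

(** Here [V = nilres N k.+1 K] is the unique minimal normal subgroup, hence an elementary abelian
    r-group, and [S] is the r-core of the preceding residual [X]. *)
Lemma last_nilres_structure (N k : nat) (gT : finGroupType) (K : {group gT}) :
    #|K| <= N -> solvable K -> nilres N k.+1 K != 1 ->
    (forall M : {group gT}, M <| K -> M :!=: 1 -> nilres N k.+1 K \subset M) ->
  exists r, exists2 S : {group gT}, [/\ r.-abelem (nilres N k.+1 K), r.-group S,
      S <| K, S :!=: 1 & S \subset 'C(nilres N k.+1 K)]
    & [/\ r^'.-group (nilres N k K / S), nilres N k (K / S) != 1
        & forall P : {group gT}, P \subset nilres N k K -> r^'.-group P ->
            P \subset 'C(nilres N k.+1 K) -> P :=: 1].
Proof.
move=> leKN solK; set X := nilres_group N k K; set V := nilres_group N k.+1 K.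
rewrite -[nilres N k.+1 K]/(gval V) -[nilres N k K]/(gval X) => ntV minV.
have nsXK : X <| K := char_normal (nilres_char N k K).
have nsVK : V <| K := char_normal (nilres_char N k.+1 K).
have sVX : V \subset X := lcn_sub N X.
have nsVX : V <| X := normalS sVX (normal_sub nsXK) nsVK.
have leN (H : {group gT}) : H \subset K -> #|H| <= N.
  by move=> sHK; apply: leq_trans (subset_leq_card sHK) leKN.
have N_gt0 : 0 < N := leq_trans (cardG_gt0 K) leKN.
have minnV : minnormal V K.
  apply/mingroupP; rewrite ntV normal_norm //; split=> // M /andP[ntM nMK] sMV.
  apply/eqP; rewrite eqEsubset sMV minV //.
  by rewrite /normal nMK (subset_trans sMV) ?normal_sub.
have [_ _ /is_abelemP[r r_pr abelV]] := minnormal_solvable minnV (normal_sub nsVK) solK.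
have [rV cVV _] := and3P abelV.
have nilXV : nilpotent (X / V).
  rewrite -(@lcn_bound_eq1 N); last by rewrite (leq_trans (leq_quotient _ _)) ?leN ?normal_sub.
  have -> : 'L_N(X / V) = 'L_N(X) / V by rewrite [RHS]morphim_lcn ?normal_norm.
  exact/eqP/(trivg_quotient V).
pose S := 'O_r(X)%G.
have nsSX : S <| X := pcore_normal r X.
have nsSK : S <| K := char_normal_trans (pcore_char r X) nsXK.
have rS : r.-group S := pcore_pgroup r X.
have sVS : V \subset S by rewrite pcore_max.
have nsVS : V <| S := normalS sVS (normal_sub nsSX) nsVX.
(* [X / V] is nilpotent and [V] is an r-group, so the r-core of [X] is a full Sylow subgroup. *)
have hallS : r.-Hall(X) S.
  by rewrite -(pquotient_pHall rV nsVX nsVS) -pquotient_pcore // nilpotent_pcore_Hall.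
have r'XS : r^'.-group (X / S).
  by rewrite /pgroup card_quotient ?normal_norm //; case/and3P: hallS.
have ntXS : X / S != 1.
  apply: contra ntV; rewrite -subG1 quotient_sub1 ?normal_norm // => sXS.
  by rewrite -[gval V]/('L_N(X)) lcn_bound_eq1 ?leN ?normal_sub // (pgroup_nil (pgroupS sXS rS)).
have ntS : S :!=: 1 by apply: contraNneq ntV => S1; rewrite -subG1 -S1.
have cSV : S \subset 'C(V).
  have nsZK : V :&: 'Z(S) <| K.
    by rewrite normalI // (char_normal_trans (center_char S)).
  have := minV (V :&: 'Z(S))%G nsZK (meet_center_nil (pgroup_nil rS) nsVS ntV).
  by rewrite subsetI subxx centsC /= => /subset_trans-> //; apply: subsetIr.
exists r, S; split=> //; first by rewrite -quotient_nilres // normal_norm.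
move=> P sPX r'P cPV; pose C := 'C_X(V)%G.
have nsCK : C <| K.
  apply/andP; split; first by rewrite subIset ?(normal_sub nsXK).
  by apply: normsI; rewrite ?norms_cent ?normal_norm.
(* ['L_N(C)] lies in [V], which [C] centralizes, so the next term of the series is trivial. *)
have nilC : nilpotent C.
  apply/lcnP; exists N; rewrite -[N](prednK N_gt0) lcnSn (prednK N_gt0); apply/commG1P.
  apply: subset_trans (lcnS N (subsetIl X 'C(V))) _.
  by rewrite centsC subsetIr.
have rC : r.-group C.
  apply: nil_pcoreC_trivg_pgroup => //; apply/eqP; apply: contraR ntV => ntO.
  have sVO := minV _ (char_normal_trans (pcore_char r^' C) nsCK) ntO.
  by rewrite -(setIidPl sVO) coprime_TIg // (pnat_coprime rV (pcore_pgroup _ _)).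
have rP : r.-group P by apply: pgroupS rC; rewrite subsetI sPX.
by rewrite -[gval P]setIid coprime_TIg // (pnat_coprime rP r'P).
Qed.

(** Induction on [#|K|] with [k] variable, since it drops by one on passing to [K / S]. *)
Lemma five_conjugates_nilres (N k : nat) (gT : finGroupType) (K : {group gT}) (D : {set gT}) :
    #|K| <= N -> solvable K -> D \subset K -> K \subset 'N(D) ->
  nilres N k <<D>> != 1 -> five_conjugates N k D.
Proof.
have [n leKn] := ubnP #|K|; elim: n => // n IHn in k gT K D leKn *.
move=> leKN solK sDK nDK ntD.
(* First reduction: every subset of [D] with a nontrivial residual may be assumed to generate
   [K]. *)
have [/existsP[E /and3P[sED prE ntE]] | minD] :=
    boolP [exists E : {set gT}, [&& E \subset D, <<E>> \proper K & nilres N k <<E>> != 1]].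
  have [sEK ltE] := (proper_sub prE, proper_card prE).
  have [||||||d [Dd ntd conjd]] := IHn k gT <<E>>%G (D :&: <<E>>).
  - exact: leq_trans ltE leKn.
  - exact: leq_trans (ltnW ltE) leKN.
  - exact: solvableS solK.
  - exact: subsetIr.
  - by rewrite normsI ?normG // (subset_trans sEK).
  - apply: contra ntE; rewrite -!subG1; apply: subset_trans.
    by rewrite nilresS // genS // subsetI sED subset_gen.
  by exists d; split=> // i; have /setIP[] := Dd i.
have {}minD (E : {set gT}) : E \subset D -> nilres N k <<E>> != 1 -> <<E>> = K.
  move=> sED ntE; apply/eqP; rewrite eqEproper gen_subG (subset_trans sED) //=.
  by apply: contra minD => prE; apply/existsP; exists E; rewrite sED prE.
(* By minimality of K, elements of the class of d0 that generate a group with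
   nontrivial residual generate K, hence are conjugate in that group. *)
have [d0 Dd0 ntd0] := generated_by_class leKN sDK nDK ntD.
have Kd0 := subsetP sDK d0 Dd0.
have sd0D : d0 ^: K \subset D.
  by apply/subsetP=> _ /imsetP[x Kx ->]; rewrite memJ_norm // (subsetP nDK).
have genK : <<d0 ^: K>> = K := minD _ sd0D ntd0.
have ntK : nilres N k K != 1 by rewrite -genK.
suffices [d d_cl ntd] : exists2 d : 'I_5 -> gT, forall i, d i \in d0 ^: K
    & nilres N k <<[set d i | i : 'I_5]>> != 1.
  have Dd i : d i \in D by rewrite (subsetP sd0D).
  have defK : <<[set d i | i : 'I_5]>> = K.
    by apply: minD ntd; apply/subsetP=> _ /imsetP[i _ ->].
  exists d; split=> // i j; rewrite defK.
  have /imsetP[x Kx ->] := d_cl i; have /imsetP[y Ky ->] := d_cl j.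
  by exists (x^-1 * y); rewrite ?groupM ?groupV // -conjgM mulKVg.
case: k => [|k] in IHn ntd0 ntK ntD minD *.
  (* At level 0 the residual is the group itself, so the constant family works because [d0] is
     nontrivial. *)
  exists (fun=> d0) => [_|]; first exact: class_refl.
  apply: contra ntK => /eqP triv; rewrite -subG1 /=.
  apply: (@class_gen_sub _ _ _ d0); rewrite ?genK ?norms1 //= -triv.
  by rewrite mem_gen // (imset_f (fun=> d0) (x := ord0)).
have sclK : d0 ^: K \subset K by rewrite class_subG.
(* Second reduction: if the residual survives in a proper quotient, any lifts of a solution there
   will do. *)
have [/existsP[M /and3P[nsMK ntM ntKM]] | minK] :=
    boolP [exists M : {group gT}, [&& M <| K, M :!=: 1 & nilres N k.+1 (K / M) != 1]].
  have [sMK nMK] := andP nsMK.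
  have genKM : <<(d0 ^: K) / M>> = K / M.
    by rewrite -quotient_gen ?genK // (subset_trans sclK).
  have [||||||dq [Ddq ntdq _]] := IHn k.+1 _ (K / M)%G ((d0 ^: K) / M).
  - exact: leq_trans (ltn_quotient ntM sMK) leKn.
  - exact: leq_trans (leq_quotient _ _) leKN.
  - exact: quotient_sol.
  - exact: quotientS.
  - by rewrite quotient_norms // class_norm.
  - by rewrite genKM.
  have [d [d_cl _ gend]] := lift_quotient_gen (subset_trans sclK nMK) Ddq.
  exists d => //; apply: contra ntdq => /eqP trivd.
  rewrite -gend -quotient_nilres ?trivd ?quotient1 //.
  by rewrite gen_subG; apply/subsetP=> _ /imsetP[i _ ->]; rewrite (subsetP nMK) ?(subsetP sclK).
have {}minK (M : {group gT}) : M <| K -> M :!=: 1 -> nilres N k.+1 K \subset M.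
  move=> nsMK ntM; have nMK := normal_norm nsMK.
  rewrite -quotient_sub1 ?(subset_trans (nilres_sub _ _ _)) //.
  rewrite quotient_nilres // subG1; apply: contraR minK => ntKM.
  by apply/existsP; exists M; rewrite nsMK ntM.
have [r [S [abelV rS nsSK ntS cSV] [r'XS ntKS ntP]]] :=
  last_nilres_structure leKN solK ntK minK.
set X := nilres N k K in r'XS ntP; pose V := nilres_group N k.+1 K.
have [sSK nSK] := andP nsSK.
have genKS : <<(d0 ^: K) / S>> = K / S.
  by rewrite -quotient_gen ?genK // (subset_trans sclK).
have [||||||dq [Ddq ntdq conjdq]] := IHn k _ (K / S)%G ((d0 ^: K) / S).
- exact: leq_trans (ltn_quotient ntS sSK) leKn.
- exact: leq_trans (leq_quotient _ _) leKN.
- exact: quotient_sol.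
- exact: quotientS.
- by rewrite quotient_norms // class_norm.
- by rewrite genKS.
have [d [d_cl def_dq gend]] := lift_quotient_gen (subset_trans sclK nSK) Ddq.
have [ntd|] := boolP (nilres N k.+1 <<[set d i | i : 'I_5]>> != 1); first by exists d.
pose H := <<[set d i | i : 'I_5]>>%G.
rewrite -[nilres N k.+1 _]/('L_N(nilres N k H)) negbK.
have dK i : d i \in K by rewrite (subsetP sclK).
have dH i : d i \in H by rewrite mem_gen ?imset_f.
have sHK : H \subset K by rewrite gen_subG; apply/subsetP=> _ /imsetP[i _ ->].
have leN (L : {group gT}) : L \subset K -> #|L| <= N.
  by move=> sLK; apply: leq_trans (subset_leq_card sLK) leKN.
have sBX : nilres N k H \subset X := nilresS N k sHK.
have sBK := subset_trans (nilres_sub N k H) sHK.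
rewrite lcn_bound_eq1 ?leN // => nilB.
pose P := 'O_r^'(nilres N k H)%G.
have r'P : r^'.-group P := pcore_pgroup _ _.
have sPB : P \subset nilres N k H := pcore_sub _ _.
have sPX := subset_trans sPB sBX.
(* Otherwise the nontrivial residual of [H / S] would be both an r-group and an r'-group. *)
have ntP1 : P :!=: 1.
  apply: contra ntdq => /eqP P1.
  have rB : r.-group (nilres N k H) := nil_pcoreC_trivg_pgroup nilB P1.
  rewrite -gend -quotient_nilres; last exact: subset_trans sHK nSK.
  have rBS : r.-group (nilres N k H / S) by apply: quotient_pgroup.
  have r'BS : r^'.-group (nilres N k H / S) by apply: pgroupS r'XS; apply: quotientS.
  by rewrite -[_ / S]setIid coprime_TIg // (pnat_coprime rBS r'BS).
have [rV cVV _] := and3P abelV.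
have nsVK : V <| K := char_normal (nilres_char N k.+1 K).
have nVH : H \subset 'N(V) := subset_trans sHK (normal_norm nsVK).
have nPH : H \subset 'N(P).
  by rewrite (char_norm_trans (pcore_char _ _)) // (char_norm (nilres_char _ _ _)).
have nVP : P \subset 'N(V) by rewrite (subset_trans _ nVH) // (subset_trans sPB) ?nilres_sub.
(* By coprime action on the abelian group [V], only 1 is fixed by [P] in [[~: V, P]]; hence [U] is
   chosen there. *)
have ntW : [~: V, P] != 1.
  apply: contra ntP1 => /eqP/commG1P cVP; apply/eqP/ntP => //.
  by rewrite centsC.
have [U minU sUW] := minnormal_exists ntW (normsR nVH nPH).
have sUV : U \subset V by rewrite (subset_trans sUW) // commg_subl.
have coVP : coprime #|V| #|P| by rewrite (pnat_coprime rV r'P).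
have cUP : 'C_U(P) = 1.
  by apply/trivgP; rewrite -(coprime_abel_cent_TI nVP coVP cVV) setSI.
have [|||||||u Uu nnil] := @regeneration N k gT r U _ d ord0.
- by rewrite card_ord.
- exact: abelemS sUV abelV.
- exact: minU.
- exact: solvableS sHK solK.
- exact: nilB.
- exact: cUP.
(* Conjugacy modulo [S] is enough, since [S] centralizes [V] and so [U]. *)
- move=> i; have [hq] := conjdq ord0 i; rewrite -gend => /morphimP[h nSh Hh ->].
  rewrite -!def_dq => def_di; exists h => //; apply: (subsetP (centS sUV)).
  have nSd j : d j \in 'N(S) by rewrite (subsetP nSK).
  apply/(subsetP cSV)/coset_idr; first by rewrite groupM ?groupV ?groupJ.
  by rewrite morphM ?morphV ?morphJ ?groupV ?groupJ //= def_di mulVg.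
have Kdu i : d i ^ u i \in K.
  by rewrite groupJ // (subsetP (normal_sub nsVK)) // (subsetP sUV).
exists (fun i => d i ^ u i) => [i|].
  have /imsetP[x Kx def_di] := d_cl i; rewrite def_di -conjgM imset_f // groupM //.
  by rewrite (subsetP (normal_sub nsVK)) // (subsetP sUV).
rewrite -[nilres N k.+1 _]/('L_N(nilres N k <<[set d i ^ u i | i : 'I_5]>>)).
rewrite lcn_bound_eq1 ?leN // (subset_trans (nilres_sub _ _ _)) // gen_subG.
by apply/subsetP=> _ /imsetP[i _ ->].
Qed.

(** * From five conjugates to ten: Baer-Suzuki and the induction on the group *)

Lemma nilres_sub_leq (N : nat) (gT : finGroupType) (G : {group gT}) m k :
  k <= m -> nilres N m G \subset nilres N k G.
Proof.
move=> /subnK <-; elim: (m - k) => // j IHj.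
exact: subset_trans (lcn_sub N (nilres_group N (j + k) G)) IHj.
Qed.

Lemma nilresJ (N k : nat) (gT : finGroupType) (G : {group gT}) x :
  nilres N k (G :^ x) = nilres N k G :^ x.
Proof.
have := morphim_nilres N k (conjgm_morphism G x) (subxx G).
by rewrite !morphim_conj setIid (setIidPr (nilres_sub N k G)).
Qed.

Lemma sol_nilres_uniform (N : nat) (gT : finGroupType) (P : pred {set gT}) :
    1 < N -> (forall E, P E -> solvable <<E>>) ->
  exists m, forall E, P E -> nilres N m <<E>> = 1.
Proof.
move=> N_gt1 solP.
have [E | f f_triv] := @fin_all_exists _ _ (fun E k => P E -> nilres N k <<E>> = 1).
  have [PE | _] := boolP (P E); last by exists 0.
  by have [k triv] := sol_nilres N_gt1 (solP E PE); exists k.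
exists (\max_E f E) => E PE; apply/trivgP; rewrite -(f_triv E PE).
exact/nilres_sub_leq/leq_bigmax.
Qed.

(** Sets of at most ten elements replace tuples; the hypothesis then passes to quotients by lifting
    each element separately. *)
Lemma sol_class_of_ten_conjugates (gT : finGroupType) (G : {group gT}) x :
    x \in G ->
    (forall E : {set gT}, E \subset x ^: G -> #|E| <= 10 -> solvable <<E>>) ->
  solvable <<x ^: G>>.
Proof.
have [n leGn] := ubnP #|G|; elim: n => // n IHn in gT G x leGn *.
move=> Gx sol10; have sCG : x ^: G \subset G by rewrite class_subG.
have [x1 | ntx] := eqVneq x 1; first by rewrite x1 class1G genGid solvable1.
have ntG : G :!=: 1 by apply: contraNneq ntx => G1; rewrite G1 inE in Gx.
set N := #|G|; have N_gt1 : 1 < N by rewrite cardG_gt1.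
pose P (E : {set gT}) := (E \subset x ^: G) && (#|E| <= 10).
have solP E : P E -> solvable <<E>> by case/andP; apply: sol10.
have [m trivm] := sol_nilres_uniform N_gt1 solP.
(* The largest such [k] is one less than the greatest height of a subgroup generated by at most ten
   conjugates. *)
pose Q k := [exists E : {set gT}, P E && (nilres N k <<E>> != 1)].
have exQ : exists k, Q k.
  exists 0; apply/existsP; exists [set x]; rewrite /P sub1set class_refl cards1 /=.
  by rewrite cycle_eq1.
have maxQ k : Q k -> k <= m.
  case/existsP=> E /andP[PE ntE]; rewrite leqNgt; apply: contra ntE => /ltnW lt_mk.
  by rewrite -subG1 -(trivm E PE) nilres_sub_leq.
case: (ex_maxnP exQ maxQ) => k /existsP[E /andP[PE ntE]] max_k.
have {}triv_k A : P A -> nilres N k.+1 <<A>> = 1.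
  move=> PA; apply/eqP; apply/idPn=> ntA.
  suffices /max_k: Q k.+1 by rewrite ltnn.
  by apply/existsP; exists A; rewrite PA.
have [sEC E10] := andP PE; have sEG := subset_trans sEC sCG.
pose D := x ^: G :&: <<E>>.
have sKG : <<E>> \subset G by rewrite gen_subG.
have leN (L : {group gT}) : L \subset G -> #|L| <= N by apply: subset_leq_card.
have [|||||d [Dd ntd _]] := @five_conjugates_nilres N k gT <<E>>%G D.
- exact: leN.
- exact: sol10.
- exact: subsetIr.
- by rewrite normsI ?normG // (subset_trans sKG) ?class_norm.
- apply: contra ntE; rewrite -!subG1; apply: subset_trans.
  by rewrite nilresS // genS // subsetI sEC subset_gen.
pose H := <<[set d i | i : 'I_5]>>%G; pose R := nilres_group N k H.
have Cd i : d i \in x ^: G by have /setIP[] := Dd i.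
have sdC : [set d i | i : 'I_5] \subset x ^: G.
  by apply/subsetP=> _ /imsetP[i _ ->].
have [q_pr] : prime (pdiv #|R|) by rewrite pdiv_prime // cardG_gt1.
set q := pdiv _ in q_pr; have [y Ry oy] := Cauchy q_pr (pdiv_dvd #|R|).
have sRG : R \subset G.
  by rewrite (subset_trans (nilres_sub N k H)) // gen_subG (subset_trans sdC).
have Gy := subsetP sRG y Ry.
have qy : q.-elt y by rewrite /p_elt oy pnat_id.
have Oy : y \in 'O_q(G).
  (* Ten is five plus five: [A] joins the generators of [H] to their conjugates by [g]. Maximality
     of [k] makes the residual [T] of [<<A>>] nilpotent, so its q-elements [y] and [y ^ g] lie in
     its q-core. *)
  apply: Baer_Suzuki => // g Gg; pose A := [set d i | i : 'I_5] :|: [set d i | i : 'I_5] :^ g.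
  have sdgC : [set d i | i : 'I_5] :^ g \subset x ^: G.
    by rewrite -(normsP (class_norm x G) g Gg) conjSg.
  have PA : P A.
    rewrite /P subUset sdC sdgC (leq_trans (leq_card_setU _ _)) //= cardJg.
    by rewrite -[10]/(5 + 5) leq_add // (leq_trans (leq_imset_card _ _)) ?card_ord.
  pose T := nilres_group N k <<A>>.
  have sAG : <<A>> \subset G by rewrite gen_subG subUset !(subset_trans _ sCG).
  have nilT : nilpotent T.
    rewrite -(@lcn_bound_eq1 N); first exact/eqP/triv_k.
    by rewrite leN // (subset_trans (nilres_sub _ _ _)).
  have sRT : R \subset T by rewrite nilresS // genS // subsetUl.
  have sRgT : R :^ g \subset T by rewrite -nilresJ nilresS //= -genJ genS // subsetUr.
  have hallT := nilpotent_pcore_Hall q nilT.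
  apply: pgroupS (pcore_pgroup q T); rewrite gen_subG subUset !sub1set.
  rewrite !(mem_normal_Hall hallT) ?pcore_normal ?p_eltJ ?qy //.
    by rewrite (subsetP sRgT) ?memJ_conjg.
  by rewrite (subsetP sRT).
set M := 'O_q(G)%G; have nsMG : M <| G := pcore_normal q G.
have [sMG nMG] := andP nsMG.
have ntM : M :!=: 1.
  apply/eqP=> M1; move: Oy; rewrite -[ 'O_q(G)]/(gval M) M1 => /set1P y1.
  by move: q_pr; rewrite -oy y1 order1.
have nMx := subsetP nMG x Gx.
have clM : coset M x ^: (G / M) = (x ^: G) / M by rewrite [RHS]morphim_class.
have solCM : solvable (<<x ^: G>> / M).
  rewrite quotient_gen ?(subset_trans sCG) // -clM.
  apply: IHn; first exact: leq_trans (ltn_quotient ntM sMG) leGn.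
    exact: mem_quotient.
  rewrite clM => Eq sEq Eq10.
  pose lift (u : coset_of M) := repr [set z in x ^: G | coset M z == u].
  have liftP u : u \in Eq -> lift u \in x ^: G /\ coset M (lift u) = u.
    move=> /(subsetP sEq)/morphimP[z _ Cz def_u].
    suffices : lift u \in [set z in x ^: G | coset M z == u] by rewrite inE => /andP[? /eqP].
    by apply: (mem_repr z); rewrite inE Cz def_u /=.
  have sEC' : lift @: Eq \subset x ^: G.
    by apply/subsetP=> _ /imsetP[u Eu ->]; case: (liftP u Eu).
  have nME : lift @: Eq \subset 'N(M) by rewrite (subset_trans sEC') // (subset_trans sCG).
  have <- : <<lift @: Eq>> / M = <<Eq>>.
    rewrite quotient_gen // /quotient morphimEsub // -imset_comp; congr <<_>>.
    rewrite -[RHS]imset_id; apply: eq_in_imset => u Eu /=; by case: (liftP u Eu).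
  by rewrite quotient_sol // sol10 // (leq_trans (leq_imset_card _ _)).
have nsMY : M <| M <*> <<x ^: G>>.
  by rewrite /normal joing_subl join_subG normG gen_subG (subset_trans sCG).
apply: (solvableS (joing_subr M <<x ^: G>>)).
rewrite (series_sol nsMY) (pgroup_sol (pcore_pgroup q G)) /=.
by rewrite quotientYidl // gen_subG (subset_trans sCG).
Qed.

Theorem lemma3p6 (gT : finGroupType) (G : {group gT}) (C : {set gT})
    (hC : C \in classes G)
    (h10 : forall x : 10.-tuple gT, (forall i : 'I_10, tnth x i \in C) ->
       solvable <<[set y in x]>>%g) :
  solvable <<C>>%g.
Proof.
have /imsetP[x Gx defC] := hC; rewrite defC.
apply: sol_class_of_ten_conjugates => // E sEC E10.
have [-> | [z Ez]] := set_0Vmem E; first by rewrite gen0 solvable1.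
(* The enumeration of [E] is padded with copies of [z] to length ten, which is why the empty set is
   treated apart. *)
have [sE10 tEz] : size (enum E) <= 10 /\ size (enum E ++ nseq (10 - #|E|) z) == 10.
  by rewrite size_cat size_nseq -cardE subnKC.
have -> : E = [set y in Tuple tEz].
  apply/setP=> y; rewrite inE /= mem_cat mem_enum mem_nseq.
  by rewrite orb_idr // => /andP[_ /eqP->].
apply: h10 => i; rewrite defC (subsetP sEC) //.
have := mem_tnth i (Tuple tEz); rewrite /= mem_cat mem_enum mem_nseq.
by case/orP=> // /andP[_ /eqP->].
Qed.
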